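(* Let $G=(V,E)$ be a finite connected block graph with boundary $\delta\Omega\subseteq V$, and suppose $|\delta\Omega|\ge 2$. Let $L$ be the boundary diameter of $G$, that is, the maximum graph distance in $G$ between two vertices of $\delta\Omega$, and let $B$ be the maximum size of the blocks of $G$. Then the first (non-trivial) Steklov eigenvalue $\lambda_2=\lambda_2(G,\delta\Omega)$ satisfies $$\lambda_2\le\frac{B}{L}.$$
   Context: All graphs are finite, simple and undirected. A block of a graph is a maximal connected subgraph that has no cut vertex of its own (so a single edge $K_2$ may be a block); the size of a block is its number of vertices. A block graph is a connected graph all of whose blocks are complete graphs. The boundary $\delta\Omega$ of a graph $G=(V,E)$ is a chosen non-empty subset of $V$ (not necessarily consisting of leaves). For $f\in\mathbb{R}^V$ put $$R(f)=\frac{\sum_{(x,y)\in E}(f(x)-f(y))^2}{\sum_{x\in\delta\Omega}f(x)^2},$$ where each undirected edge is counted once, with the convention $R(f)=+\infty$ if $f$ vanishes identically on $\delta\Omega$. The Steklov eigenvalues $0=\lambda_1\le\lambda_2\le\cdots\le\lambda_{|\delta\Omega|}$ of $(G,\delta\Omega)$ are $$\lambda_k(G,\delta\Omega)=\min_{W\subset\mathbb{R}^V,\ \dim W=k}\ \max_{0\ne f\in W}R(f),\qquad 1\le k\le|\delta\Omega|,$$ with $W$ ranging over linear subspaces. *)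

(* Defs.v *)
From HB Require Import structures.
From mathcomp Require Import all_boot all_order all_algebra.
From mathcomp Require Import all_classical all_reals all_analysis.

Set Implicit Arguments.
Unset Strict Implicit.
Unset Printing Implicit Defensive.

Import Order.TTheory GRing.Theory Num.Theory.
Local Open Scope ring_scope.

Section Graphs.
Variable T : finType.
Implicit Types (e : rel T) (H K : {set T} * {set T * T}) (v x y : T).

(* A graph whose vertices lie in T is a pair H of a vertex set H.1 and of a set
   H.2 of arcs, an undirected edge xy being recorded by both (x, y) and (y, x). *)
Definition adj H : rel T := fun x y => (x, y) \in H.2.

Definition whole_graph e : {set T} * {set T * T} :=
  ([set: T]%SET, [set p : T * T | e p.1 p.2]%SET).

(* Subgraphs need not be induced. *)
Definition subgraph K H : bool := (K.1 \subset H.1) && (K.2 \subset H.2).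

Definition is_graph H : bool :=
  [forall x, forall y, adj H x y ==>
     [&& x \in H.1, y \in H.1, x != y & adj H y x]].

Definition connected_graph H : bool :=
  [exists x, x \in H.1] &&
  [forall x in H.1, forall y in H.1, connect (adj H) x y].

Definition delete_vertex H v : {set T} * {set T * T} :=
  ((H.1 :\ v)%SET, [set p in H.2 | (p.1 != v) && (p.2 != v)]%SET).

(* Deleting v disconnects two of the remaining vertices of a component of H;
   in particular neither K_1 nor K_2 has a cut vertex. *)
Definition cut_vertex H v : bool :=
  (v \in H.1) &&
  [exists x in (delete_vertex H v).1, exists y in (delete_vertex H v).1,
     connect (adj H) x y && ~~ connect (adj (delete_vertex H v)) x y].

Definition nonseparable H : bool :=
  [&& is_graph H, connected_graph H & [forall v, ~~ cut_vertex H v]].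

Definition is_block e K : bool :=
  [&& subgraph K (whole_graph e), nonseparable K &
      [forall H : {set T} * {set T * T},
         [&& subgraph H (whole_graph e), nonseparable H & subgraph K H]
           ==> (H == K)]].

Definition complete_graph H : bool :=
  [forall x in H.1, forall y in H.1, (x != y) ==> adj H x y].

Definition block_graph e : bool :=
  connected_graph (whole_graph e) &&
  [forall K : {set T} * {set T * T}, is_block e K ==> complete_graph K].

Definition max_block_size e : nat :=
  (\max_(K : {set T} * {set T * T} | is_block e K) #|K.1|)%N.

(* Least length of a walk from x to y. Lengths below #|T| suffice when x and y
   are connected; otherwise the value is the junk value #|T|. *)
Definition gdist e x y : nat :=
  \big[minn/#|T|]_(n < #|T| |
     [exists p : n.-tuple T, path e x p && (last x p == y)]) (n : nat).

Definition boundary_diameter e (D : {set T}) : nat :=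
  (\max_(x in D) \max_(y in D) gdist e x y)%N.

End Graphs.

Section Steklov.
Variables (R : realType) (T : finType) (e : rel T) (D : {set T}).
Implicit Type f : {ffun T -> R^o}.

(* The double sum meets every undirected edge twice. *)
Definition dirichlet_energy f : R :=
  2^-1 * \sum_(x : T) \sum_(y : T | e x y) (f x - f y) ^+ 2.

Definition rayleigh f : \bar R :=
  if [forall x in D, f x == 0] then +oo%E
  else (dirichlet_energy f / \sum_(x in D) (f x) ^+ 2)%:E.

(* Both extrema are attained for 1 <= k <= #|D|. *)
Definition steklov_eigenvalue (k : nat) : \bar R :=
  ereal_inf [set r | exists2 W : {vspace {ffun T -> R^o}}, \dim W = k &
    r = ereal_sup [set rayleigh f | f in
          [set f : {ffun T -> R^o} | f \in W /\ f != 0]]]%classic.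

End Steklov.

(* Main.v *)
(** Let [x_0, ..., x_L] be a geodesic between two boundary vertices at distance
    [L], and let [C_i] be the maximal clique containing [x_i] and [x_(i+1)].
    In a block graph a clique stays a clique when a simple path joining two of
    its vertices is added, because the union is nonseparable and so lies in a
    block. Hence distinct [C_i] share no edge and deleting the edges of [C_i]
    puts its vertices in distinct components. Let [h_i] be [-1] on the component
    of [x_i], [1] on that of [x_(i+1)] and [0] elsewhere. Then [f = sum_i h_i]
    equals [-L] at [x_0] and [L] at [x_L], and its Dirichlet energy is
    [sum_i 2 |C_i| <= 2 B L]. On the span of [1] and [f] the Rayleigh quotient
    is at most [2 B L / (2 L^2) = B / L]. *)
Require Import Defs.
From HB Require Import structures.
From mathcomp Require Import all_boot all_order all_algebra.
From mathcomp Require Import all_classical all_reals all_analysis.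
From mathcomp Require Import ring lra zify.

Set Implicit Arguments.
Unset Strict Implicit.
Unset Printing Implicit Defensive.

Import Order.TTheory GRing.Theory Num.Theory.
Local Open Scope ring_scope.

(** * Cliques, ears and blocks *)

Section Cliques.
Variables (T : finType) (e : rel T).
Hypotheses (e_sym : symmetric e) (e_irr : irreflexive e).
Implicit Types (C S A : {set T}) (H K : {set T} * {set T * T}) (u v w x y : T).

Definition clique C : bool :=
  [forall x in C, forall y in C, (x != y) ==> e x y].

Lemma cliqueP C : reflect {in C &, forall x y, x != y -> e x y} (clique C).
Proof.
apply: (iffP forall_inP) => [cC x y xC yC|cC x xC].
  by move/implyP: (forall_inP (cC x xC) y yC); apply.
by apply/forall_inP => y yC; apply/implyP; apply: cC.
Qed.

Definition induced S : rel T := [rel x y | [&& x \in S, y \in S & e x y]].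

Definition induced_graph S : {set T} * {set T * T} :=
  (S, [set p : T * T | induced S p.1 p.2]%SET).

Lemma induced_sym S : symmetric (induced S).
Proof. by move=> x y; rewrite /induced /= andbCA e_sym. Qed.

Lemma path_induced S u p :
  path e u p -> {subset u :: p <= S} -> path (induced S) u p.
Proof.
elim: p u => //= w p IHp u /andP[uw wp] sS.
rewrite /induced /= uw !sS ?inE ?eqxx ?orbT //=.
by apply: IHp => // z zp; apply: sS; rewrite inE zp orbT.
Qed.

(* Adding an ear to a clique: as the ear is a simple path with both ends in the
   clique, removing one vertex leaves each of the others attached to the clique
   by at least one of its two sides. *)
Lemma induced_ear_connected C u p S A :
    clique C -> u \in C -> path e u p -> uniq (u :: p) -> last u p \in C ->
    S = (C :|: [set z in u :: p])%SET -> A \subset S ->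
    {in S &, forall z t, z \notin A -> t \notin A -> z = t} ->
  {in A &, forall x y, connect (induced A) x y}.
Proof.
move=> /cliqueP cC uC up Up vC defS sAS one.
have Csym := sym_connect_sym (induced_sym A).
have toC x : x \in A -> exists2 c, c \in C :&: A & connect (induced A) x c.
  move=> xA; have := fintype.subsetP sAS x xA; rewrite defS !inE -in_cons.
  case/orP => [xC|xp]; first by exists x; rewrite // inE xC.
  case/splitPl: xp up Up vC defS => p1 p2 lx.
  rewrite cat_path last_cat lx -cat_cons cat_uniq => /andP[up1 xp2] /and3P[_ dis _] vC defS.
  have S1 z : z \in u :: p1 -> z \in S.
    by move=> zp; rewrite defS inE [X in _ || X]inE mem_cat zp orbT.
  have S2 z : z \in p2 -> z \in S.
    by move=> zp; rewrite defS inE [X in _ || X]inE mem_cat zp !orbT.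
  have [/allP a1|/allPn[w w1 wA]] := boolP (all [in A] (u :: p1)).
    exists u; first by rewrite inE uC a1 ?mem_head.
    rewrite Csym; apply/connectP; exists p1 => //.
    exact: path_induced.
  (* The missing vertex [w] lies on the first half of the ear, so simplicity keeps it off the second
     half, and [one] allows no other missing vertex. *)
  have a2 : {subset x :: p2 <= A}.
    move=> z; rewrite inE => /predU1P[-> //|z2].
    apply: contraNT dis => zA; apply/hasP; exists z => //.
    by rewrite /= (one z w (S2 z z2) (S1 w w1) zA wA).
  exists (last x p2); first by rewrite inE vC a2 ?mem_last.
  by apply/connectP; exists p2 => //; apply: path_induced.
move=> x y /toC[c /finset.setIP[cC1 cA] xc] /toC[d /finset.setIP[dC dA] yd].
apply: (connect_trans xc); rewrite Csym; apply: (connect_trans yd).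
have [->//|dc] := eqVneq d c.
by apply: connect1; rewrite /induced /= dA cA cC.
Qed.

(** The previous lemma is used twice: with [A] equal to [S] for connectedness, and with [A] equal to
    [S :\ v] to exclude a cut vertex [v]. *)
Lemma nonseparable_ear C u p :
    clique C -> u \in C -> path e u p -> uniq (u :: p) -> last u p \in C ->
  nonseparable (induced_graph (C :|: [set z in u :: p])%SET).
Proof.
move=> cC uC up Up vC; set S := (_ :|: _)%SET.
have conn := induced_ear_connected cC uC up Up vC (erefl S).
have adjE K U : (forall z t, ((z, t) \in K.2) = induced U z t) -> adj K =2 induced U.
  by move=> h z t; rewrite /adj h.
apply/and3P; split.
- apply/forallP => x; apply/forallP => y; apply/implyP.
  rewrite /adj inE /= /induced /= => /and3P[xS yS exy].
  apply/and4P; split=> //; last by rewrite inE /= yS xS e_sym.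
  by apply: contraTneq exy => ->; rewrite e_irr.
- apply/andP; split; first by apply/existsP; exists u; rewrite !inE uC.
  apply/forall_inP => x xS; apply/forall_inP => y yS.
  rewrite (eq_connect (adjE _ S _)); last by move=> z t; rewrite inE.
  by apply: conn => // z t zS _; rewrite zS.
- apply/forallP => v; rewrite negb_and; apply/orP; right.
  apply/exists_inPn => x xS; apply/exists_inPn => y yS.
  rewrite negb_and negbK; apply/orP; right.
  rewrite (eq_connect (adjE _ (S :\ v)%SET _)).
    apply: conn => //; first exact: finset.subsetDl.
    move=> z t zS tS; rewrite !in_setD1 zS tS !andbT !negbK.
    by move=> /eqP-> /eqP->.
  move=> z t; rewrite /= inE /= inE /induced /= !in_setD1.
  by case: (z == v); case: (t == v); rewrite ?andbF ?andbT.
Qed.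

Lemma subgraph_trans : transitive (@subgraph T).
Proof.
move=> K H J /andP[h1 h2] /andP[k1 k2].
by rewrite /subgraph (fintype.subset_trans h1) ?(fintype.subset_trans h2).
Qed.

Lemma nonseparable_sub_block K :
    subgraph K (whole_graph e) -> nonseparable K ->
  exists2 H, is_block e H & subgraph K H.
Proof.
move=> sK nK.
(* Maximizing the number of vertices plus arcs suffices: a nonseparable supergraph of the maximizer
   can gain neither, hence equals it. *)
pose P H := [&& subgraph H (whole_graph e), nonseparable H & subgraph K H].
have PK : P K by rewrite /P sK nK /subgraph !subxx.
case: (@arg_maxnP _ K P (fun H => #|H.1| + #|H.2|)%N PK) => H /and3P[sH nH KH] maxH.
exists H => //; rewrite /is_block sH nH /=.
apply/forallP => J; apply/implyP => /and3P[sJ nJ HJ].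
have /maxH : P J by rewrite /P sJ nJ (subgraph_trans KH HJ).
case/andP: HJ => HJ1 HJ2 /= le.
have squeeze (a b c d : nat) :
    (a <= b -> c <= d -> b + d <= a + c -> (b <= a) && (d <= c))%N by lia.
have /andP[le1 le2] := squeeze _ _ _ _ (subset_leq_card HJ1) (subset_leq_card HJ2) le.
have /eqP E1 : H.1 == J.1 by rewrite eqEcard HJ1.
have /eqP E2 : H.2 == J.2 by rewrite eqEcard HJ2.
by rewrite [J]surjective_pairing -E1 -E2 -surjective_pairing.
Qed.

Hypothesis eG : block_graph e.

(** The clique and its ear lie in one block; its completeness gives the first claim and its size the
    second. *)
Lemma clique_ear C u p :
    clique C -> u \in C -> path e u p -> uniq (u :: p) -> last u p \in C ->
    clique (C :|: [set z in u :: p])%SET /\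
    (#|C| <= max_block_size e)%N.
Proof.
move=> cC uC up Up vC.
have nS := nonseparable_ear cC uC up Up vC; set S := (_ :|: _)%SET in nS *.
have sS : subgraph (induced_graph S) (whole_graph e).
  apply/andP; split; first exact: finset.subsetT.
  by apply/fintype.subsetP => z; rewrite !inE => /and3P[].
have [H bH /andP[sSH _]] := nonseparable_sub_block sS nS.
split; last first.
  apply: (leq_trans (subset_leq_card (finset.subsetUl C [set z in u :: p]%SET))).
  apply: leq_trans (subset_leq_card sSH) _.
  exact: (@leq_bigmax_cond _ (is_block e) (fun K => #|K.1|)).
apply/cliqueP => x y xS yS xy.
case/andP: eG => _ /forallP/(_ H)/implyP/(_ bH).
move=> /forall_inP/(_ _ (fintype.subsetP sSH x xS))/forall_inP/(_ _ (fintype.subsetP sSH y yS)).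
move=> /implyP/(_ xy) adjH.
case/and3P: bH => /andP[_ /fintype.subsetP s2] _ _.
by have := s2 _ adjH; rewrite inE.
Qed.

(** The trivial ear at [u] already places the clique inside a block. *)
Lemma clique_leq_max_block C u : clique C -> u \in C -> (#|C| <= max_block_size e)%N.
Proof. by move=> cC uC; have [] := @clique_ear C u [::] cC uC. Qed.

Lemma max_clique_ear C u p :
    maxset clique C -> u \in C -> path e u p -> uniq (u :: p) ->
    last u p \in C ->
  {subset u :: p <= C}.
Proof.
move=> /maxsetP[cC maxC] uC up Up vC z zp.
have [cS _] := clique_ear cC uC up Up vC.
by rewrite -(maxC _ cS) ?finset.subsetUl // !inE -in_cons zp orbT.
Qed.

(** For any other [w] in [C'], the path [u], [w], [v] is an ear of [C], so [w] lies in [C]. *)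
Lemma max_clique_inter C C' u v :
    maxset clique C -> maxset clique C' -> u != v ->
    u \in C -> v \in C -> u \in C' -> v \in C' ->
  C = C'.
Proof.
move=> mC mC' uv uC vC uC' vC'.
have /maxsetP[/cliqueP cC' _] := mC'; have /maxsetP[_ maxC'] := mC'.
apply: maxC'; first by case/maxsetP: mC.
apply/fintype.subsetP => w wC'.
have [->//|wu] := eqVneq w u; have [->//|wv] := eqVneq w v.
have sub := @max_clique_ear C u [:: w; v] mC uC.
apply: sub; rewrite ?mem_head //= ?inE ?eqxx ?orbT //.
  by rewrite !cC' // eq_sym.
by rewrite negb_or uv eq_sym wu wv.
Qed.

Definition off_clique C : rel T := [rel x y | e x y && ~~ ((x \in C) && (y \in C))].

Lemma off_clique_sym C : connect_sym (off_clique C).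
Proof.
by apply: sym_connect_sym => x y; rewrite /off_clique /= e_sym [(x \in C) && _]andbC.
Qed.

(** A nontrivial simple path between two vertices of [C] is an ear, so it stays in [C] and its first
    edge is one of the deleted ones. *)
Lemma off_clique_connect C : maxset clique C ->
  {in C &, forall u v, connect (off_clique C) u v = (u == v)}.
Proof.
move=> mC u v uC vC; apply/idP/eqP => [/connectP[p0 up0 defv]|->//].
move: vC; rewrite defv; case/shortenP: up0 => p up Up _ {p0 defv}.
case: p up Up => //= w p /andP[/andP[uw nuw] wp] Up vC; case/negP: nuw.
have sub : {subset u :: w :: p <= C}.
  apply: max_clique_ear => //=; rewrite uw /=.
  by apply: sub_path wp => x y /andP[].
by rewrite uC sub // !inE eqxx orbT.
Qed.

End Cliques.

(** * Graph distance and geodesics *)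

Section Distance.
Variables (T : finType) (e : rel T).
Implicit Types (D : {set T}) (u v : T) (p : seq T).

Lemma bigminn_leq (I : eqType) (r : seq I) (P : pred I) (F : I -> nat) m i :
  i \in r -> P i -> (\big[minn/m]_(j <- r | P j) F j <= F i)%N.
Proof.
elim: r => // j r IHr; rewrite inE big_cons => /predU1P[<- ->|ir Pi].
  exact: geq_minl.
have := IHr ir Pi; case: ifP => // _; apply: leq_trans; exact: geq_minr.
Qed.

Lemma gdist_leq u v p : path e u p -> last u p = v -> (gdist e u v <= size p)%N.
Proof.
move=> up <-; have [leTp|ltpT] := leqP #|T| (size p).
  (* The minimum never exceeds its default value [#|T|], which settles long walks. *)
  apply: leq_trans leTp; rewrite /gdist.
  elim/big_ind: _ => // [a b a_le _|i _]; last exact/ltnW/ltn_ord.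
  exact: leq_trans (geq_minl a b) a_le.
apply: (@bigminn_leq _ _ _ _ _ (Ordinal ltpT)); first exact: mem_index_enum.
by apply/existsP; exists (in_tuple p); rewrite up /=.
Qed.

Lemma gdist_path u v : connect e u v ->
  exists p, [/\ path e u p, last u p = v & size p = gdist e u v].
Proof.
move=> /connectP[p0 up0 defv].
(* A simple path has fewer than [#|T|] edges, so the minimum is not the default value and some walk
   attains it. *)
have ltT : (gdist e u v < #|T|)%N.
  move: defv; case/shortenP: up0 => p up Up _ defv.
  apply: leq_ltn_trans (gdist_leq up (esym defv)) _.
  by have := max_card [in u :: p]; rewrite (card_uniqP Up).
have : gdist e u v = #|T| \/
    exists p, [/\ path e u p, last u p = v & size p = gdist e u v].
  rewrite /gdist; elim/big_ind: _ => [|a b Pa Pb|]; first by left.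
    by rewrite /minn; case: ifP.
  move=> n /existsP[p /andP[up /eqP pv]]; right; exists p.
  by rewrite size_tuple.
by case=> // eqT; rewrite eqT ltnn in ltT.
Qed.

(* [p] is cut at its [i]-th and [j]-th vertices; bypassing the part in between
   would give a shorter path. *)
Lemma geodesic_no_shortcut u v p i j :
    path e u p -> last u p = v -> size p = gdist e u v ->
    (i.+1 < j)%N -> (j <= size p)%N ->
  (last u (take i p) != last u (take j p)) &&
  ~~ e (last u (take i p)) (last u (take j p)).
Proof.
move=> up pv sp ij jp; pose x k := last u (take k p); rewrite -!/(x _).
have cut k : path e u (take k p) /\ path e (x k) (drop k p).
  by apply/andP; rewrite -cat_path cat_take_drop.
have ldrop k : last (x k) (drop k p) = v by rewrite -last_cat cat_take_drop.
have [ui _] := cut i; have [_ jv] := cut j.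
apply/andP; split.
  apply/eqP => xij.
  have := @gdist_leq u v (take i p ++ drop j p).
  rewrite cat_path last_cat ui /= -/(x i) xij jv ldrop => /(_ isT erefl).
  by rewrite size_cat size_drop size_takel; lia.
apply/negP => xij.
have := @gdist_leq u v (take i p ++ x j :: drop j p).
rewrite cat_path last_cat ui /= -/(x i) xij jv ldrop => /(_ isT erefl).
by rewrite size_cat /= size_drop size_takel; lia.
Qed.

Lemma boundary_geodesic D :
    (forall u v, connect e u v) -> (2 <= #|D|)%N ->
  exists x : nat -> T, let L := boundary_diameter e D in
    [/\ (0 < L)%N, x 0%N \in D, x L \in D,
        forall i, (i < L)%N -> e (x i) (x i.+1) &
        forall i j, (i.+1 < j)%N -> (j <= L)%N ->
          (x i != x j) && ~~ e (x i) (x j)].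
Proof.
move=> econn D2.
have D0 : (0 < #|D|)%N by apply: leq_trans D2.
have [u uD Lu] := eq_bigmax_cond (fun u => \max_(v in D) gdist e u v)%N D0.
have [v vD Lv] := eq_bigmax_cond (gdist e u) D0.
have [p [up pv sp]] := gdist_path (econn u v).
have LE : boundary_diameter e D = size p by rewrite /boundary_diameter Lu Lv.
exists (fun k => last u (take k p)) => /=; rewrite LE.
rewrite take0 take_size pv; split=> //.
(* Two distinct boundary vertices are at positive distance, whence [0 < L]. *)
- have /card_gt1P[a [b [aD bD ab]]] := D2.
  have : (gdist e a b <= boundary_diameter e D)%N.
    apply: (@leq_trans (\max_(v in D) gdist e a v)%N).
      exact: (@leq_bigmax_cond _ [in D] (gdist e a) b).
    exact: (@leq_bigmax_cond _ [in D] (fun u => \max_(v in D) gdist e u v)%N a).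
  rewrite LE; apply: leq_trans.
  have [[|c q] [aq qb <-]] := gdist_path (econn a b) => //.
  by rewrite -qb /= eqxx in ab.
- move=> i ip; move: up; rewrite -{1}(cat_take_drop i.+1 p) cat_path => /andP[+ _].
  by rewrite (take_nth u ip) rcons_path last_rcons => /andP[].
- by move=> i j ij jp; exact: (geodesic_no_shortcut up pv).
Qed.

End Distance.

(** * Step functions across cliques and their energy *)

Section CliqueSteps.
Variables (R : realType) (T : finType) (e : rel T).
Hypotheses (e_sym : symmetric e) (e_irr : irreflexive e) (eG : block_graph e).
Implicit Types (C : {set T}) (a b v x y : T).

Lemma sum_sqr_diff (C : {set T}) (h : T -> R) :
  \sum_(x in C) \sum_(y in C) (h x - h y) ^+ 2 =
  2 * (#|C|%:R * \sum_(x in C) h x ^+ 2 - (\sum_(x in C) h x) ^+ 2).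
Proof.
under eq_bigr => x _.
  under eq_bigr => y _ do rewrite sqrrB.
  rewrite big_split /= sumrB sumr_const sumrMnl -mulr_sumr.
  over.
rewrite /= big_split sumrB /= sumr_const !sumrMnl -mulr_suml.
by rewrite -[X in X - _ + _]mulr_natl -[X in _ + X]mulr_natl; ring.
Qed.

(** Edges off [C] contribute nothing, and the diagonal pairs added on the right vanish. *)
Lemma sum_edges_clique C (h : T -> R) :
    clique e C -> (forall x y, off_clique e C x y -> h x = h y) ->
  \sum_x \sum_(y | e x y) (h x - h y) ^+ 2 =
  \sum_(x in C) \sum_(y in C) (h x - h y) ^+ 2.
Proof.
move=> /cliqueP cC hoff; rewrite [RHS]big_mkcond /=.
apply: eq_bigr => x _; rewrite big_mkcond /=.
have [xC|xC] := ifP; last first.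
  apply: big1 => y _; case: ifP => // exy.
  by rewrite (hoff x y) ?subrr ?expr0n //= /off_clique /= exy xC.
rewrite [RHS]big_mkcond; apply: eq_bigr => y _ /=.
have [yC|yC] := boolP (y \in C).
  have [->|xy] := eqVneq x y; first by rewrite subrr expr0n /= if_same.
  by rewrite cC.
case: ifP => // exy.
by rewrite (hoff x y) ?subrr ?expr0n //= /off_clique /= exy (negPf yC) andbF.
Qed.

(** This is [h_i] of the overview, for [C_i = C], [x_i = a] and [x_(i+1) = b]. *)
Definition clique_step C a b v : R :=
  (connect (off_clique e C) b v)%:R - (connect (off_clique e C) a v)%:R.

Lemma clique_step_off C a b x y :
  off_clique e C x y -> clique_step C a b x = clique_step C a b y.
Proof.
move=> /connect1 xy; have osym := off_clique_sym e_sym C.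
by rewrite /clique_step !(same_connect_r osym xy).
Qed.

(** On [C] the step is -1 at [a], 1 at [b] and 0 elsewhere: its sum is 0 and its square sum 2. The
    double sum counts each edge twice, so this is twice the energy [2 |C|]. *)
Lemma clique_step_energy C a b :
    maxset (clique e) C -> a \in C -> b \in C -> a != b ->
  \sum_x \sum_(y | e x y) (clique_step C a b x - clique_step C a b y) ^+ 2 =
  4 * #|C|%:R.
Proof.
move=> mC aC bC ab.
rewrite (@sum_edges_clique C); first last.
- exact: clique_step_off.
- by case/maxsetP: mC.
have stepE x : x \in C -> clique_step C a b x = (b == x)%:R - (a == x)%:R.
  by move=> xC; rewrite /clique_step !(off_clique_connect e_sym e_irr eG mC).
have sum1 c : c \in C -> \sum_(x in C) (c == x)%:R = 1 :> R.
  move=> cC; rewrite (bigD1 c) //= eqxx big1 ?addr0 // => x /andP[_ xc].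
  by rewrite eq_sym (negPf xc).
rewrite sum_sqr_diff (eq_bigr _ stepE) sumrB !sum1 // subrr expr0n subr0.
have -> : \sum_(x in C) clique_step C a b x ^+ 2 = 2.
  transitivity (\sum_(x in C) ((b == x)%:R + (a == x)%:R) : R).
    apply: eq_bigr => x xC; rewrite stepE //.
    have [<-|_] := eqVneq b x; last by case: (a == x) => /=; ring.
    by rewrite (negPf ab) /=; ring.
  by rewrite big_split /= !sum1.
by ring.
Qed.

(* The test function is the sum of the steps across the maximal cliques that
   contain the edges of the geodesic. These cliques share no edge, so along any
   given edge at most one of the steps varies and the energies add up. *)
Lemma geodesic_test_function (L : nat) (x : nat -> T) :
    (forall i, (i < L)%N -> e (x i) (x i.+1)) ->
    (forall i j, (i.+1 < j)%N -> (j <= L)%N -> (x i != x j) && ~~ e (x i) (x j)) ->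
  exists f : T -> R, [/\ f (x 0%N) = - L%:R, f (x L) = L%:R &
    \sum_u \sum_(v | e u v) (f u - f v) ^+ 2 <= 4 * (max_block_size e)%:R * L%:R].
Proof.
move=> xe xfar.
have neq i : (i < L)%N -> x i != x i.+1.
  by move=> iL; apply: contraTneq (xe i iL) => <-; rewrite e_irr.
have ext (i : 'I_L) : {C : {set T} | maxset (clique e) C & [set x i; x i.+1]%SET \subset C}.
  apply: maxset_exists; apply/cliqueP => y z; rewrite !inE.
  by do 2!case/pred2P=> ->; rewrite ?eqxx // => _; [|rewrite e_sym]; apply: xe.
pose C i := s2val (ext i).
have mC i : maxset (clique e) (C i) := s2valP (ext i).
have C0 (i : 'I_L) : x i \in C i by apply: (fintype.subsetP (s2valP' (ext i))); rewrite !inE eqxx.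
have C1 (i : 'I_L) : x i.+1 \in C i.
  by apply: (fintype.subsetP (s2valP' (ext i))); rewrite !inE eqxx orbT.
(* Geodesic vertices more than one step apart are distinct and nonadjacent, so they share no
   clique. *)
have near (i : 'I_L) j k : x j \in C i -> x k \in C i -> (k <= L)%N -> (k <= j.+1)%N.
  move=> jC kC kL; rewrite leqNgt; apply/negP => jk.
  have /andP[neqjk /negP[]] := xfar _ _ jk kL.
  by case/maxsetP: (mC i) => /cliqueP cC _; apply: cC.
have Cdisj i j : i != j -> forall u v, u != v -> u \in C i -> v \in C i ->
    ~~ ((u \in C j) && (v \in C j)).
  (* If [C k = C l], this clique contains both [x l] and [x k.+1], and [near] gives [k.+1 <= l.+1].
     By symmetry distinct indices give distinct cliques. *)
  have eqC (k l : 'I_L) : C k = C l -> (k <= l)%N.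
    move=> E; have := @near l l k.+1 (C0 l); rewrite -E => /(_ (C1 k)).
    exact.
  move=> ij u v uv uCi vCi; apply: contra ij => /andP[uCj vCj].
  have E := max_clique_inter e_sym e_irr eG (mC i) (mC j) uv uCi vCi uCj vCj.
  by rewrite -val_eqE eqn_leq !eqC.
pose h i := clique_step (C i) (x i) (x i.+1).
have osym i := off_clique_sym e_sym (C i).
have nconn (i : 'I_L) : connect (off_clique e (C i)) (x i) (x i.+1) = false.
  by rewrite (off_clique_connect e_sym e_irr eG (mC i)) // (negPf (neq i _)).
exists (fun v => \sum_i h i v); split.
- transitivity (\sum_(i < L) (-1 : R)); last by rewrite sumr_const card_ord mulNrn.
  apply: eq_bigr => i _; rewrite /h /clique_step.
  (* By [near], the geodesic from [x 0] to [x i] uses no edge of [C i], so each step equals -1 at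
     [x 0]. *)
  have con j : (j <= i)%N -> connect (off_clique e (C i)) (x j) (x 0%N).
    elim: j => // j IHj ji; rewrite osym.
    apply: connect_trans (_ : connect _ (x 0%N) (x j)) _.
      by rewrite osym IHj // ltnW.
    apply: connect1; rewrite /off_clique /= xe ?(ltn_trans ji) //=.
    apply/negP => /andP[jC _]; have := near i _ _ jC (C1 i) (ltn_ord i).
    by rewrite ltnS leqNgt ji.
  rewrite (con i (leqnn i)) (_ : connect _ _ _ = false) ?sub0r //.
  by rewrite osym -(same_connect (osym i) (con i (leqnn i))) nconn.
- transitivity (\sum_(i < L) (1 : R)); last by rewrite sumr_const card_ord.
  apply: eq_bigr => i _; rewrite /h /clique_step.
  (* Likewise the rest of the geodesic, from [x i.+1] to [x L], avoids the edges of [C i]. *)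
  have con j : (i < j)%N -> (j <= L)%N -> connect (off_clique e (C i)) (x i.+1) (x j).
    elim: j => // j IHj; rewrite ltnS leq_eqVlt => /predU1P[->//|ij] jL.
    apply: connect_trans (IHj ij (ltnW jL)) _.
    apply: connect1; rewrite /off_clique /= xe //=.
    apply/negP => /andP[_ jC]; have := near i _ _ (C0 i) jC jL.
    by rewrite ltnS leqNgt ij.
  have conL := con L (ltn_ord i) (leqnn L).
  by rewrite conL -(same_connect_r (osym i) conL) nconn subr0.
have -> : \sum_u \sum_(v | e u v) (\sum_i h i u - \sum_i h i v) ^+ 2 =
    \sum_(i < L) 4 * #|C i|%:R :> R.
  transitivity (\sum_(i < L) \sum_u \sum_(v | e u v) (h i u - h i v) ^+ 2); last first.
    by apply: eq_bigr => i _; rewrite clique_step_energy // neq.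
  rewrite exchange_big /=; apply: eq_bigr => u _.
  rewrite exchange_big /=; apply: eq_bigr => v uv.
  rewrite -sumrB.
  have flat i : ~~ ((u \in C i) && (v \in C i)) -> h i u - h i v = 0.
    by move=> nC; rewrite /h (@clique_step_off _ _ _ u v) ?subrr // /off_clique /= uv.
  have [/existsP[i /andP[ui vi]]|no] := boolP [exists i, (u \in C i) && (v \in C i)].
    have neuv : u != v by apply: contraTneq uv => ->; rewrite e_irr.
    have zero j : j != i -> h j u - h j v = 0.
      move=> ji; apply: flat; apply: (Cdisj i j _ u v) => //.
      by rewrite eq_sym.
    rewrite (bigD1 i) //= big1 // addr0 [RHS](bigD1 i) //= big1 ?addr0 // => j ji.
    by rewrite zero // expr0n.
  rewrite !big1 ?expr0n //= => i _; rewrite flat ?expr0n //;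
  by apply: contra no => iC; apply/existsP; exists i.
apply: (@le_trans _ _ (\sum_(i < L) 4 * (max_block_size e)%:R)).
  apply: ler_sum => i _; rewrite ler_pM2l // ler_nat.
  apply: (clique_leq_max_block e_sym e_irr eG _ (C0 i)).
  by case/maxsetP: (mC i).
by rewrite sumr_const card_ord -[leLHS]mulr_natr.
Qed.

End CliqueSteps.

(** * Bounding the Steklov eigenvalue by a test plane *)

Section Steklov.
Variables (R : realType) (T : finType) (e : rel T) (D : {set T}).
Implicit Types (u v : T) (f : T -> R).

Lemma steklov_eigenvalue_le (k : nat) (W : {vspace {ffun T -> R^o}}) (M : \bar R) :
    \dim W = k -> (forall f : {ffun T -> R^o}, f \in W -> f != 0 -> (rayleigh e D f <= M)%E) ->
  (steklov_eigenvalue R e D k <= M)%E.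
Proof.
move=> dimW WM; apply: ge_ereal_inf; eexists; first by exists W.
by apply: ge_ereal_sup => _ [f [fW f0] <-]; apply: WM.
Qed.

(* Tested on the plane spanned by the constants and [f]: the Dirichlet energy
   ignores the constant part, while (a - bt)^2 + (a + bt)^2 >= 2 b^2 t^2. *)
Lemma steklov_eigenvalue2_le f u v (t E : R) :
    u \in D -> v \in D -> 0 < t -> f u = - t -> f v = t ->
    \sum_x \sum_(y | e x y) (f x - f y) ^+ 2 <= E ->
  (steklov_eigenvalue R e D 2 <= (E / (4 * t ^+ 2))%:E)%E.
Proof.
move=> uD vD t0 fu fv leE.
pose one : {ffun T -> R^o} := [ffun _ => 1].
pose g : {ffun T -> R^o} := [ffun x => f x].
(* The plane has dimension 2 because [f] is nonzero and takes opposite values at [u] and [v], so the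
   constants are not among its multiples. *)
have freeW : free [:: one; g].
  rewrite free_cons span_seq1 seq1_free; apply/andP; split; last first.
    apply/eqP => /ffunP/(_ v); rewrite !ffunE fv => t00.
    by rewrite t00 ltxx in t0.
  apply/negP => /vlineP[c] /ffunP cE.
  have := cE u; have := cE v; rewrite !ffunE fu fv.
  change (1 = c * t -> 1 = c * - t -> False) => c1 c2; lra.
apply: (@steklov_eigenvalue_le _ <<[:: one; g]>>); first exact/eqP.
move=> w; rewrite span_cons span_seq1.
case/memv_addP => _ /vlineP[a ->] [_ /vlineP[b ->] ->].
set w' := _ + _ => w0.
have wE x : w' x = a + b * f x.
  by rewrite !ffunE; change (a * 1 + b * f x = a + b * f x); rewrite mulr1.
have den : 2 * a ^+ 2 + 2 * (b * t) ^+ 2 <= \sum_(x in D) w' x ^+ 2.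
  have uv : u != v by apply: contraTneq t0 => uv; move: fu; rewrite uv fv => ?; lra.
  rewrite (bigD1 u) //= (bigD1 v) ?vD 1?eq_sym //= !wE fu fv addrA.
  apply: ler_wpDr; first by apply: sumr_ge0 => x _; apply: sqr_ge0.
  by rewrite le_eqVlt; apply/orP; left; apply/eqP; ring.
have ab0 : 0 < 2 * a ^+ 2 + 2 * (b * t) ^+ 2.
  rewrite lt_neqAle eq_sym; apply/andP; split; last first.
    by apply: addr_ge0; apply: mulr_ge0; rewrite // sqr_ge0.
  apply: contra w0 => /eqP ab0.
  have a2 := sqr_ge0 a; have b2 := sqr_ge0 (b * t).
  have /eqP : a ^+ 2 = 0 by lra.
  have /eqP : (b * t) ^+ 2 = 0 by lra.
  rewrite !sqrf_eq0 mulf_eq0 (gt_eqF t0) orbF => /eqP b0 /eqP a0.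
  by apply/eqP/ffunP => x; rewrite wE a0 b0 ffunE mul0r addr0.
(* The infinite value does not occur: vanishing at [u] and [v] would force [a = 0] and
   [b * t = 0]. *)
rewrite /rayleigh; case: ifPn => [/forall_inP wD|_].
  have /eqP := wD u uD; have /eqP := wD v vD; rewrite !wE fu fv => h1 h2.
  have a0 : a = 0 by lra.
  have bt0 : b * t = 0 by lra.
  by rewrite a0 bt0 expr0n mulr0 addr0 ltxx in ab0.
have E0 : 0 <= E.
  by apply: le_trans leE; apply: sumr_ge0 => x _; apply: sumr_ge0 => y _; apply: sqr_ge0.
rewrite lee_fin ler_pdivrMr ?(lt_le_trans ab0) //.
have -> : dirichlet_energy e w' =
    2^-1 * (b ^+ 2 * \sum_x \sum_(y | e x y) (f x - f y) ^+ 2).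
  congr (_ * _); rewrite mulr_sumr; apply: eq_bigr => x _.
  by rewrite mulr_sumr; apply: eq_bigr => y _; rewrite !wE; ring.
apply: (@le_trans _ _ (2^-1 * (b ^+ 2 * E))).
  by rewrite ler_pM2l ?invr_gt0 // ler_wpM2l // sqr_ge0.
(* The 4 combines the factor 1/2 of the energy with the factor 2 of the boundary bound. *)
have -> : 2^-1 * (b ^+ 2 * E) = E / (4 * t ^+ 2) * (2 * (b * t) ^+ 2).
  by field; rewrite gt_eqF.
rewrite ler_wpM2l ?divr_ge0 ?mulr_ge0 ?sqr_ge0 ?(ltW t0) //.
by apply: le_trans den; rewrite lerDr mulr_ge0 // sqr_ge0.
Qed.

End Steklov.

Theorem theorem1p4 (R : realType) (T : finType) (e : rel T) (D : {set T})
    (e_sym : symmetric e) (e_irr : irreflexive e)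
    (eG : block_graph e) (D2 : (2 <= #|D|)%N) :
  (steklov_eigenvalue R e D 2 <=
     ((max_block_size e)%:R / (boundary_diameter e D)%:R)%:E)%E.
Proof.
have econn u v : connect e u v.
  case/andP: eG => /andP[_ /forall_inP conn] _.
  have := forall_inP (conn u (finset.in_setT u)) v (finset.in_setT v).
  by rewrite (@eq_connect _ _ e) // => x y; rewrite /adj inE.
have [x [L0 x0D xLD xe xfar]] := boundary_geodesic econn D2.
have [f [f0 fL fE]] := geodesic_test_function R e_sym e_irr eG xe xfar.
have LR : 0 < (boundary_diameter e D)%:R :> R by rewrite ltr0n.
apply: (le_trans (steklov_eigenvalue2_le x0D xLD LR f0 fL fE)).
(* With [E = 4 B L] and [t = L] the bound is [4 B L / (4 L^2) = B / L]. *)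
rewrite lee_fin le_eqVlt; apply/orP; left; apply/eqP.
by field; rewrite gt_eqF.
Qed.
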